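(* Let $G$ and $H$ be finite $Cpo$-groups with $|G|=55$ and $|H|=22$. Then $|Cent(G)|=|Cent(H)|=13$, $|G'|=|H'|=11$, and $G$ and $H$ are not isoclinic.
   Context: A finite group $G$ is called a $Cpo$-group if for every non-trivial element $x\in G$ the order of the centralizer $C_G(x)$ is a prime number. For a group $G$, $Cent(G)=\{C_G(x)\mid x\in G\}$ denotes the set of all element centralizers of $G$, and $G'$ is the derived (commutator) subgroup. Two groups $G$ and $H$ are isoclinic if there are isomorphisms $\varphi: G/Z(G)\to H/Z(H)$ and $\phi: G'\to H'$ such that whenever $\varphi(g_1Z(G))=h_1Z(H)$ and $\varphi(g_2Z(G))=h_2Z(H)$ with $g_1,g_2\in G$, $h_1,h_2\in H$, one has $\phi([g_1,g_2])=[h_1,h_2]$. *)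

(* Defs.v *)
From HB Require Import structures.
From mathcomp Require Import all_boot all_fingroup all_solvable.

Set Implicit Arguments.
Unset Strict Implicit.
Unset Printing Implicit Defensive.

Local Open Scope group_scope.

Definition Cpo_group (gT : finGroupType) (G : {group gT}) : Prop :=
  forall x : gT, x \in G -> x != 1 -> prime #|'C_G[x]|.

Definition Cent (gT : finGroupType) (G : {group gT}) : {set {set gT}} :=
  [set 'C_G[x] | x in G].

(* For g \in G, coset 'Z(G) g is the genuine coset g * 'Z(G), as G normalises  *)
(* 'Z(G). Since phi and psi are morphisms on the whole source group, isom says *)
(* exactly that they are bijective onto the target group.                      *)
Definition isoclinic (gT rT : finGroupType) (G : {group gT}) (H : {group rT})
    : Prop :=
  exists (phi : {morphism G / 'Z(G) >-> coset_of 'Z(H)})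
         (psi : {morphism G^`(1) >-> rT}),
    [/\ isom (G / 'Z(G)) (H / 'Z(H)) phi,
        isom G^`(1) H^`(1) psi
      & forall (g1 g2 : gT) (h1 h2 : rT),
          g1 \in G -> g2 \in G -> h1 \in H -> h2 \in H ->
          phi (coset 'Z(G) g1) = coset 'Z(H) h1 ->
          phi (coset 'Z(G) g2) = coset 'Z(H) h2 ->
          psi [~ g1, g2] = [~ h1, h2]].

(* Main.v *)
Require Import Defs.
From HB Require Import structures.
From mathcomp Require Import all_boot all_fingroup all_solvable.

Local Open Scope group_scope.

(* Let G be a Cpo-group of order p * q with q < p primes. Its centre is       *)
(* trivial, its Sylow p-subgroup P is normal, and G / P is abelian, so        *)
(* G' = P. Every centraliser other than G has prime order p or q, hence is a  *)
(* Sylow subgroup, and conversely. Two normal Sylow subgroups of coprime      *)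
(* orders would commute, so there are p Sylow q-subgroups, and p + 2          *)
(* centralisers. As the centres are trivial, isoclinism would force equal     *)
(* orders.                                                                    *)

(** Both orders are 11 times a smaller prime, 5 or 2. The counts in [card_Cent_pq] and
    [card_der1_pq] depend only on p = 11, so they agree for the two groups, whereas the orders of
    the central quotients, by [center_pq] those of the groups, differ. *)

Lemma Cpo_center (gT : finGroupType) (G : {group gT}) :
  Cpo_group G -> ~~ prime #|G| -> 'Z(G) = 1.
Proof.
move=> cpoG nprG; apply/trivgP/subsetP=> x /setIP[Gx cGx].
rewrite inE; apply: contraR nprG => ntx.
have sGx : G \subset 'C[x] by rewrite sub_cent1.
by have := cpoG x Gx ntx; rewrite (setIidPl sGx).
Qed.

(** A group of prime order is abelian, so it lies in the centraliser of each of its elements; both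
    orders being prime, divisibility forces equality. *)
Lemma Cpo_cent1_prime (gT : finGroupType) (G P : {group gT}) (x : gT) :
  Cpo_group G -> P \subset G -> prime #|P| -> x \in P -> x != 1 ->
  'C_G[x] = P.
Proof.
move=> cpoG sPG prP Px ntx; have Gx := subsetP sPG x Px.
have sPC : P \subset 'C_G[x].
  by rewrite subsetI sPG sub_cent1 (subsetP (cyclic_abelian (prime_cyclic prP))).
apply/esym/eqP; rewrite eqEcard sPC /=.
have:= cardSg sPC; rewrite (dvdn_prime2 prP (cpoG x Gx ntx)).
by move/eqP->.
Qed.

Section OrderPQ.

Variables (gT : finGroupType) (G : {group gT}) (p q : nat).
Hypotheses (cpoG : Cpo_group G) (pr_p : prime p) (pr_q : prime q).
Hypotheses (ltqp : q < p) (oG : #|G| = (p * q)%N).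

Let co_pq : coprime p q.
Proof. by rewrite prime_coprime // dvdn_prime2 // gtn_eqF. Qed.

Let card_Sylow_p (P : {group gT}) : p.-Sylow(G) P -> #|P| = p.
Proof.
move=> sylP; rewrite (card_Hall sylP) oG p_part lognM ?prime_gt0 //.
by rewrite lognE pr_p prime_gt0 // dvdnn divnn prime_gt0 //= logn1
  (logn_coprime co_pq).
Qed.

Let card_Sylow_q (Q : {group gT}) : q.-Sylow(G) Q -> #|Q| = q.
Proof.
move=> sylQ; rewrite (card_Hall sylQ) oG p_part lognM ?prime_gt0 //.
rewrite logn_coprime 1?coprime_sym //.
by rewrite lognE pr_q prime_gt0 // dvdnn divnn prime_gt0 //= logn1.
Qed.

Lemma center_pq : 'Z(G) = 1.
Proof.
apply: Cpo_center => //; rewrite oG; apply/negP => pr_pq.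
have := dvdn_mulr q (dvdnn p); rewrite (dvdn_prime2 pr_p pr_pq).
by rewrite -{1}[p]muln1 eqn_pmul2l ?prime_gt0 // ltn_eqF ?prime_gt1.
Qed.

(** Being 1 mod p, the count is coprime to p, so it divides q < p and equals its own residue. *)
Lemma card_Syl_p_pq : #|'Syl_p(G)| = 1%N.
Proof.
have modS := card_Syl_mod G pr_p.
have coS : coprime #|'Syl_p(G)| p.
  by rewrite /coprime -gcdn_modl modS gcd1n.
have := card_Syl_dvd p G; rewrite oG Gauss_dvdr // => /(dvdn_leq (prime_gt0 pr_q)).
by move=> /leq_ltn_trans/(_ ltqp) ltS; rewrite -modS modn_small.
Qed.

Lemma normal_Sylow_pq : exists2 P : {group gT}, p.-Sylow(G) P & P <| G.
Proof. by apply/normal_sylowP; rewrite card_Syl_p_pq. Qed.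

Lemma card_der1_pq : #|G^`(1)| = p.
Proof.
have [P sylP nPG] := normal_Sylow_pq; have oP := card_Sylow_p P sylP.
have sG'P : G^`(1) \subset P.
  apply: der1_min; first exact: normal_norm.
  apply/cyclic_abelian/prime_cyclic.
  rewrite card_quotient ?normal_norm // -divgS ?normal_sub //.
  by rewrite oG oP mulKn ?prime_gt0.
have := cardSg sG'P; rewrite oP; move/primeP: (pr_p) => [_ +] => /[apply].
(* If G' were trivial, G would be abelian and so equal to its trivial centre. *)
case/orP=> /eqP // /eqP; rewrite -trivg_card1 => /eqP G'1.
have /center_idP : abelian G by rewrite /abelian (sameP commG1P eqP) -derg1 G'1.
rewrite center_pq => G1; have := oG; rewrite -G1 cards1 => /esym/eqP.
by rewrite muln_eq1 gtn_eqF // prime_gt1.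
Qed.

Lemma card_Syl_q_pq : #|'Syl_q(G)| = p.
Proof.
have coS : coprime #|'Syl_q(G)| q.
  by rewrite /coprime -gcdn_modl card_Syl_mod // gcd1n.
have := card_Syl_dvd q G; rewrite oG Gauss_dvdl //.
(* The count is 1 or p; the value 1 makes a Sylow q-subgroup Q normal and is refuted below. *)
move/primeP: (pr_p) => [_ +] => /[apply] /orP[/normal_sylowP | /eqP //].
case=> Q sylQ nQG; have [P sylP nPG] := normal_Sylow_pq.
have [oP oQ] := (card_Sylow_p P sylP, card_Sylow_q Q sylQ).
have tiPQ : P :&: Q = 1 by rewrite coprime_TIg // oP oQ.
have cPQ : P \subset 'C(Q).
  apply/commG1P/trivgP; rewrite -tiPQ subsetI commg_subl commg_subr.
  by rewrite (subset_trans _ (normal_norm nPG)) ?(subset_trans _ (normal_norm nQG))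
    ?normal_sub.
have [x Px ntx] : exists2 x, x \in P & x != 1.
  by apply/trivgPn; rewrite trivg_card1 oP gtn_eqF ?prime_gt1.
(* The centraliser of x contains Q but equals P, so q would divide p. *)
have sQC : Q \subset 'C_G[x].
  by rewrite subsetI normal_sub // sub_cent1 (subsetP cPQ).
have CxP : 'C_G[x] = P by rewrite (@Cpo_cent1_prime _ G P x) ?normal_sub ?oP.
have := cardSg sQC; rewrite /= CxP oP oQ dvdn_prime2 // => /eqP eqp.
by have := ltqp; rewrite eqp ltnn.
Qed.

Lemma card_Cent_pq : #|Cent G| = p.+2.
Proof.
have [P sylP nPG] := normal_Sylow_pq; have oP := card_Sylow_p P sylP.
(* Underlying sets are taken because [Cent G] is a set of sets. *)
pose SylQ := [set (Q : {set gT}) | Q : {group gT} in 'Syl_q(G)].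
have CentP (R : {group gT}) : R \subset G -> prime #|R| -> (R : {set gT}) \in Cent G.
  move=> sRG prR; have [x Rx ntx] : exists2 x, x \in R & x != 1.
    by apply/trivgPn; rewrite trivg_card1 gtn_eqF ?prime_gt1.
  apply/imsetP; exists x; first exact: (subsetP sRG).
  by rewrite (@Cpo_cent1_prime _ G R x).
have SylQ_card A : A \in SylQ -> #|A| = q.
  by case/imsetP=> Q; rewrite inE => /card_Sylow_q oQ ->.
have -> : Cent G = (G : {set gT}) |: ((P : {set gT}) |: SylQ).
  apply/eqP; rewrite eqEsubset; apply/andP; split; apply/subsetP=> A.
    case/imsetP=> x Gx ->; have [-> | ntx] := eqVneq x 1.
      by rewrite cent11T setIT setU11.
    have prC := cpoG x Gx ntx; have := cardSg (subsetIl G 'C[x]).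
    rewrite oG Euclid_dvdM // !dvdn_prime2 // !inE.
    case/orP=> /eqP oC.
      (* The normal Sylow subgroup P contains every p-subgroup of G. *)
      suff -> : 'C_G[x] = P by rewrite eqxx orbT.
      apply/eqP; rewrite eqEcard oC oP leqnn andbT.
      by rewrite (sub_normal_Hall sylP) ?subsetIl // /pgroup oC pnat_id.
    rewrite (_ : 'C_G[x] \in SylQ) ?orbT //; apply/imsetP.
    exists [group of 'C_G[x]] => //; rewrite inE pHallE subsetIl /= oC oG.
    rewrite partnM ?prime_gt0 // (@part_pnat_id _ q) ?pnat_id // part_p'nat ?mul1n //.
    by rewrite p'natE // dvdn_prime2 // ltn_eqF.
  case/setU1P=> [-> | /setU1P[-> | /imsetP[Q]]].
  - by apply/imsetP; exists 1; rewrite ?cent11T ?setIT.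
  - by apply: CentP; rewrite ?normal_sub ?oP.
  rewrite inE => sylQ ->; apply: CentP; first exact: pHall_sub sylQ.
  by rewrite (card_Sylow_q Q sylQ).
(* The three pieces are disjoint: their members have orders pq, p and q. This gives 1 + 1 + p. *)
rewrite !cardsU1 card_imset; last exact: group_inj.
rewrite card_Syl_q_pq; set b1 := _ \notin _; set b2 := _ \notin _.
have -> : b2 by apply/negP=> /SylQ_card; rewrite oP => eqp; have := ltqp; rewrite eqp ltnn.
have -> // : b1.
rewrite /b1 !inE negb_or; apply/andP; split.
  apply/eqP=> eqGP; have := oG; rewrite eqGP oP => /eqP.
  by rewrite -{1}[p]muln1 eqn_pmul2l ?prime_gt0 // ltn_eqF ?prime_gt1.
apply/negP=> /SylQ_card; rewrite oG => /eqP.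
by rewrite -{2}[q]mul1n eqn_pmul2r ?prime_gt0 // gtn_eqF ?prime_gt1.
Qed.

End OrderPQ.

Lemma isoclinic_center1_card (gT rT : finGroupType)
    (G : {group gT}) (H : {group rT}) :
  'Z(G) = 1 -> 'Z(H) = 1 -> isoclinic G H -> #|G| = #|H|.
Proof.
move=> ZG ZH [phi [_ [/isom_card + _ _]]].
by rewrite !card_quotient ?gFnorm //= ZG ZH !indexg1.
Qed.

Theorem mainTheorem1 (gT rT : finGroupType) (G : {group gT}) (H : {group rT})
    (cpoG : Cpo_group G) (cpoH : Cpo_group H)
    (oG : #|G| = 55%N) (oH : #|H| = 22%N) :
  [/\ #|Cent G| = 13%N /\ #|Cent H| = 13%N,
      #|G^`(1)| = 11%N /\ #|H^`(1)| = 11%N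
    & ~ isoclinic G H].
Proof.
have oG' : #|G| = (11 * 5)%N by [].
have oH' : #|H| = (11 * 2)%N by [].
split; first by rewrite (@card_Cent_pq _ G 11 5) ?(@card_Cent_pq _ H 11 2).
  by rewrite (@card_der1_pq _ G 11 5) ?(@card_der1_pq _ H 11 2).
move/isoclinic_center1_card; rewrite oG oH.
by rewrite (@center_pq _ G 11 5) ?(@center_pq _ H 11 2) // => /(_ erefl erefl).
Qed.
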